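(* Let $(X,T)$ be a Polish dynamical system. If $V\subseteq\mathcal{M}_T(X)$ is closed, then $G^V=\{x\in X: V\subseteq V(x)\}$ is a $\boldsymbol{\Pi}^0_2$ set.
   Context: A Polish dynamical system $(X,T)$ is a Polish space $X$ (not assumed compact) with a continuous map $T\colon X\to X$. $\mathcal{M}(X)$ is the space of Borel probability measures on $X$ with the weak$^*$ topology (convergence of integrals of bounded continuous functions); $\mathcal{M}_T(X)$ is the subspace of $T$-invariant measures. For $x\in X$, $n\ge1$, $\mathcal{E}(x,n)=\frac1n\sum_{j=0}^{n-1}\delta_{T^j(x)}$, and $V(x)$ is the set of limit points (limits of convergent subsequences) in $\mathcal{M}(X)$ of $(\mathcal{E}(x,n))_n$. $\boldsymbol{\Pi}^0_2$ sets are the $G_\delta$ sets. *)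

(* Defs.v *)
From HB Require Import structures.
From mathcomp Require Import all_boot all_order all_algebra.
From mathcomp Require Import all_classical all_reals all_analysis.
From mathcomp Require Import borel_hierarchy.

Set Implicit Arguments.
Unset Strict Implicit.
Unset Printing Implicit Defensive.

Import Order.TTheory GRing.Theory Num.Theory.
Import numFieldNormedType.Exports.

Local Open Scope classical_set_scope.
Local Open Scope ring_scope.

Section polish.
Context (R : realType) (X : topologicalType).

Definition is_metric (dist : X -> X -> R) :=
  [/\ forall x, dist x x = 0,
      forall x y, dist x y = 0 -> x = y,
      forall x y, dist x y = dist y x &
      forall x y z, dist x z <= dist x y + dist y z].

Definition metrizes (dist : X -> X -> R) :=
  forall (x : X) (A : set X),
    nbhs x A <-> exists2 e : R, 0 < e & [set y | dist x y < e] `<=` A.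

Definition cauchy_seq (dist : X -> X -> R) (u : nat -> X) :=
  forall e : R, 0 < e ->
    exists N : nat, forall m n, (N <= m)%N -> (N <= n)%N -> dist (u m) (u n) < e.

Definition complete_dist (dist : X -> X -> R) :=
  forall u : nat -> X, cauchy_seq dist u -> exists l : X, u @ \oo --> l.

Definition separable := exists2 D : set X, countable D & dense D.

(* The metric is only required to exist: being Polish is a property of the
   topology. *)
Definition polish :=
  separable /\
  exists dist : X -> X -> R,
    [/\ is_metric dist, metrizes dist & complete_dist dist].

End polish.

Definition borel (X : ptopologicalType) : measurableType (@open X).-sigma :=
  g_sigma_algebraType (@open X).

Section weak_star_topology.
Context (R : realType) (X : ptopologicalType).

Definition bcfun := {f : X -> R | continuous f /\ bounded_fun f}.

Definition integral_map (mu : probability (borel X) R) :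
    prod_topology (fun _ : bcfun => R) :=
  fun f => \int[mu]_x (sval f x).

(* The coarsest topology for which [mu |-> \int f dmu] is continuous for every
   bounded continuous f. An element of [probability] also carries values on
   non-Borel sets; measures that agree on Borel sets are topologically
   indistinguishable here, so closed sets and limits do not see those values. *)
Definition borel_prob := initial_topology integral_map.

HB.instance Definition _ := Topological.on borel_prob.

Lemma cvg_borel_probP (F : set_system borel_prob) (mu : borel_prob) :
  Filter F ->
  F --> mu <->
  forall f : bcfun, integral_map nu f @[nu --> F] --> integral_map mu f.
Proof.
move=> FF; split=> [Fmu f|Fmu].
  have Fim : integral_map nu @[nu --> F] --> integral_map mu.
    by move=> A /(@initial_continuous _ _ integral_map mu)/Fmu.
  move=> A /(@initial_continuous _ _ (fun g : bcfun -> R => g f)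
    (integral_map mu)) fA.
  by move/cvg_sup : Fim => /(_ f) /(_ _ fA).
have Fim : integral_map nu @[nu --> F] --> integral_map mu.
  apply/cvg_sup => f A /= [_ [[B oB <-] /= Bf]] /filterS; apply.
  by apply: (Fmu f); exact: open_nbhs_nbhs.
move=> A /= [_ [[B oB <-] Bmu]] /filterS; apply.
by apply: Fim; exact: open_nbhs_nbhs.
Qed.

End weak_star_topology.

Section dynamics.
Context (R : realType) (X : ptopologicalType) (T : X -> X).

Definition invariant_measures : set (borel_prob R X) :=
  [set mu : probability (borel X) R |
    forall A : set (borel X), measurable A ->
      pushforward mu (T : borel X -> borel X) A = mu A].

Section empirical.
Variables (x : X) (n : nat).

Definition empirical_measure : set (borel X) -> \bar R :=
  mscale (n.+1%:R^-1)%:nng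
    (msum (fun j => \d_(iter j T x : borel X)) n.+1).

HB.instance Definition _ := Measure.on empirical_measure.

Lemma empirical_measure_setT : empirical_measure setT = 1%E.
Proof.
rewrite /empirical_measure /mscale/= /msum.
rewrite (eq_bigr (fun=> 1%E)); last by move=> i _; exact: diracT.
by rewrite sumEFin sumr_const card_ord -EFinM mulVf// pnatr_eq0.
Qed.

HB.instance Definition _ :=
  Measure_isProbability.Build _ _ _ empirical_measure empirical_measure_setT.

End empirical.

(* The shift makes the sequence [n >= 1] start at index 0:
   [empirical x n] is the average of the Dirac masses at the n + 1 points
   x, T x, ..., T^n x. *)
Definition empirical (x : X) (n : nat) : borel_prob R X :=
  (empirical_measure x n : probability (borel X) R).

Definition limit_measures (x : X) : set (borel_prob R X) :=
  [set mu | exists2 s : nat -> nat, {homo s : m n / (m < n)%N} &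
     empirical x (s k) @[k --> \oo] --> mu].

End dynamics.

(* Main.v *)
(** The weak* topology on the Borel probability measures of a separable metric
    space has a countable subbase. Fix a dense sequence and consider the
    truncated cones max(0, c - q d(e_k, .)) with c rational and q natural, and
    their finite maxima h. Every nonnegative bounded continuous function g is an
    increasing limit of such h, so monotone convergence makes \int h dmu
    arbitrarily close to \int g dmu with h <= g. Applying this to M + f and
    M - f shows that the countably many sets {nu | a < \int h dnu}, a rational,
    form a subbase.
    Let U range over the resulting countable base. A measure mu is a limit point
    of the empirical measures of x iff every U containing mu is visited
    infinitely often. Hence V is contained in V(x) iff every U meeting V is
    visited infinitely often, and each set {x | E(x, n) in U} is open because
    x |-> \int h dE(x, n) is a Birkhoff average of h. *)

Require Import Defs.
From mathcomp Require Import all_boot all_order all_algebra.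
From mathcomp Require Import all_classical all_reals all_analysis.
From mathcomp Require Import borel_hierarchy measurable_realfun.
From mathcomp Require Import lra.

Set Implicit Arguments.
Unset Strict Implicit.
Unset Printing Implicit Defensive.

Import Order.TTheory GRing.Theory Num.Theory.
Import numFieldNormedType.Exports.

Local Open Scope classical_set_scope.
Local Open Scope ring_scope.

(** * Integration of bounded continuous functions *)

Lemma continuous_borel_measurable (R : realType) (X : ptopologicalType)
  (f : X -> R) : continuous f -> measurable_fun setT (f : borel X -> R).
Proof.
move=> /continuousP cf; apply: (measurability _ (RGenOpens.measurableE R)).
move=> _ [_ [a [b ->] <-]]; rewrite setTI; apply: sub_sigma_algebra.
exact/cf/interval_open.
Qed.

Section bounded_continuous.
Context (R : realType) (X : ptopologicalType) (mu : probability (borel X) R).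

Lemma bcfun_integrable (f : X -> R) : continuous f -> bounded_fun f ->
  mu.-integrable setT (EFin \o (f : borel X -> R)).
Proof.
move=> cf bf; apply: measurable_bounded_integrable => //.
  by rewrite -ge0_fin_numE// fin_num_measure.
exact: continuous_borel_measurable.
Qed.

Lemma EFin_Rintegral_bcfun (f : X -> R) : continuous f -> bounded_fun f ->
  (\int[mu]_x f x)%:E = (\int[mu]_x (f x)%:E)%E.
Proof.
by move=> cf bf; rewrite fineK//; apply: integrable_fin_num => //;
  exact: bcfun_integrable.
Qed.

End bounded_continuous.

Lemma continuous_bigmax (R : realType) (X : topologicalType) (I : Type)
  (s : seq I) (F : I -> X -> R) : (forall i, continuous (F i)) ->
  continuous (fun x => \big[Num.max/0]_(i <- s) F i x).
Proof.
move=> cF; elim: s => [|i s IH] x.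
  under eq_fun do rewrite big_nil; exact: cvg_cst.
under eq_fun do rewrite big_cons.
by apply: continuous_max; [exact: cF|exact: IH].
Qed.

(** * Birkhoff averages as integrals against empirical measures *)

Section empirical_continuity.
Context (R : realType) (X : ptopologicalType) (T : X -> X).
Hypothesis cT : continuous T.

Lemma iter_continuous n : continuous (iter n T).
Proof.
elim: n => [|n IH] x; first exact: cvg_id.
by apply: (continuous_comp (f := iter n T)); [exact: IH|exact: cT].
Qed.

(** Nonnegativity lets the scaling and the finite sum of Dirac masses be pulled out of the
    extended-real integral. *)
Lemma integral_empirical (f : X -> R) x n :
  continuous f -> (forall y, 0 <= f y) ->
  \int[empirical_measure R T x n]_y f y =
  n.+1%:R^-1 * \sum_(j < n.+1) f (iter j T x).
Proof.
move=> cf f0; have mf := continuous_borel_measurable cf.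
have mEf : measurable_fun setT (fun y : borel X => (f y)%:E).
  exact/measurable_EFinP.
rewrite /Rintegral /empirical_measure ge0_integral_mscale//; last first.
  by move=> y _; rewrite lee_fin.
rewrite ge0_integral_measure_sum//; last by move=> y _; rewrite lee_fin.
under eq_bigr => j _.
  rewrite integral_dirac// diracT mul1e; over.
by rewrite sumEFin -EFinM.
Qed.

Lemma integral_empirical_continuous (f : X -> R) n :
  continuous f -> (forall y, 0 <= f y) ->
  continuous (fun x => \int[empirical_measure R T x n]_y f y).
Proof.
move=> cf f0; under eq_fun do rewrite integral_empirical//.
move=> x; apply: cvgM; first exact: cvg_cst.
apply: cvg_big => [|j _]; first exact: add_continuous.
by apply: (continuous_comp (f := iter j T)); [exact: iter_continuous|exact: cf].
Qed.

End empirical_continuity.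

(** * Cones under a continuous function and the countable subbase *)

Section bumps.
Context (R : realType) (X : ptopologicalType).
Variables (dist : X -> X -> R) (e : nat -> X).
Hypotheses (dist_metric : is_metric dist) (distE : metrizes dist).
Hypothesis e_dense : forall x (r : R), 0 < r -> exists k, dist (e k) x < r.

Let code : Type := nat * rat * nat.

(* [(k, a, q)] codes the cone of height [a] and slope [q] centred at [e k]. *)
Definition bump (c : code) (y : X) : R :=
  Num.max 0 (ratr c.1.2 - c.2%:R * dist (e c.1.1) y).

Definition bumps (s : seq code) (y : X) : R := \big[Num.max/0]_(c <- s) bump c y.

Let dist_ge0 x y : 0 <= dist x y.
Proof.
case: dist_metric => d0 _ dC dT.
by have := dT x y x; rewrite d0 (dC y x); lra.
Qed.

Lemma dist_continuous z : continuous (dist z).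
Proof.
case: dist_metric => d0 _ dC dT x; apply/cvgrPdist_lt => r r0.
apply/distE; exists r => // y /= xyr.
have := dT z x y; have := dT z y x; rewrite (dC y x) => h1 h2.
by rewrite ltr_norml; apply/andP; split; lra.
Qed.

Lemma bump_continuous c : continuous (bump c).
Proof.
move=> x; apply: (@continuous_max _ _ (fun=> 0)
  (fun y => ratr c.1.2 - c.2%:R * dist (e c.1.1) y)); first exact: cvg_cst.
apply: cvgB; first exact: cvg_cst.
by apply: cvgM; [exact: cvg_cst|exact: dist_continuous].
Qed.

Lemma bumps_continuous s : continuous (bumps s).
Proof. by apply: continuous_bigmax => c; exact: bump_continuous. Qed.

Lemma bumps_ge0 s y : 0 <= bumps s y.
Proof. exact: bigmax_ge_id. Qed.

Lemma bumps_bounded s : bounded_fun (bumps s).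
Proof.
(* The filter in [ex_bound] has to be proper; [point] shows that the space is nonempty. *)
apply/(@ex_bound _ _ _ (bumps s) _ (globally_properfilter (a := point) I)).
exists (\big[Num.max/0]_(c <- s) `|ratr c.1.2|).
move=> y _ /=.
rewrite ger0_norm ?bumps_ge0// /bumps; elim: s => [|c s IH].
  by rewrite !big_nil.
rewrite !big_cons le_max2// /bump ge_max normr_ge0/=.
rewrite (le_trans _ (ler_norm _))// gerBl// mulr_ge0//.
Qed.

Definition bumps_bcfun s : bcfun R X :=
  exist _ (bumps s) (conj (@bumps_continuous s) (bumps_bounded s)).

(** The cone has a rational height between [t] and [g x]. It is centred near [x] and steep enough to
    vanish outside a ball on which [g] exceeds that height. *)
Lemma bump_below (g : X -> R) (x : X) (t : R) : continuous g ->
  (forall y, 0 <= g y) -> 0 <= t -> t < g x ->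
  exists2 c, (forall y, bump c y <= g y) & t < bump c x.
Proof.
move=> cg g0 t0 tx; case: dist_metric => d0 _ dC dT.
have [a] := rat_in_itvoo tx; rewrite in_itv/= => /andP[ta ax].
have : nbhs x [set y | ratr a < g y].
  by apply: (cg x [set z | ratr a < z]); exact: lt_nbhsr.
move=> /distE[r r0 rg].
have [q aq] : exists q : nat, ratr a < q%:R * (r / 2).
  exists (Num.bound (ratr a / (r / 2))).
  rewrite -ltr_pdivrMr ?divr_gt0//.
  apply: archi_boundP; rewrite divr_ge0//; lra.
have q0 : 0 < q%:R :> R by nra.
(* The bound [r / 2] leaves every point outside the ball at distance more than [r / 2] from [e k],
   where the cone is 0. The other bound keeps the loss of height at [x] below [ratr a - t]. *)
have [k kx] : exists k, dist (e k) x < Num.min (r / 2) ((ratr a - t) / q%:R).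
  by apply: e_dense; rewrite lt_min divr_gt0//= divr_gt0// subr_gt0.
move: kx; rewrite lt_min (ltr_pdivlMr _ _ q0) => /andP[kr kt].
exists (k, a, q) => [y|]; rewrite /bump/=; last first.
  by rewrite lt_max; apply/orP; right; lra.
rewrite ge_max g0/=; have [xy|ry] := ltP (dist x y) r.
  by have /= := rg y xy; have := dist_ge0 (e k) y; nra.
have := dT x (e k) y; rewrite (dC x (e k)) => h.
by have := g0 y; nra.
Qed.

Lemma integral_bumps_below (mu : probability (borel X) R) (g : X -> R) (t : R) :
  continuous g -> bounded_fun g -> (forall y, 0 <= g y) -> t < \int[mu]_x g x ->
  exists2 s, (forall y, bumps s y <= g y) & t < \int[mu]_x bumps s x.
Proof.
move=> cg bg g0 tg.
(* Only codes of index below [n] are listed, so the maxima grow with [n], and every cone lying under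
   [g] is eventually included. *)
pose s n := [seq c <- pmap unpickle (iota 0 n)
              | `[< forall y, bump c y <= g y >]] : seq code.
have sg n y : bumps (s n) y <= g y.
  by rewrite /bumps big_filter; apply: bigmax_le => // c /asboolP; exact.
have s_mono y : {homo (fun n => bumps (s n) y) : m n / (m <= n)%N >-> m <= n}.
  move=> m n mn; apply: sub_bigmax_seq => c; rewrite !mem_filter => /andP[-> /=].
  rewrite !mem_pmap => /mapP[i + ic]; rewrite mem_iota/= add0n => im.
  by apply/mapP; exists i => //; rewrite mem_iota/= add0n (leq_trans im).
have s_cvg y : (bumps (s n) y)%:E @[n --> \oo] --> (g y)%:E.
  apply: cvg_EFin; first by apply: nearW.
  apply/cvgrPdist_lt => r r0.
  (* [bump_below] needs a nonnegative level; for a negative one, [bumps_ge0] is enough. *)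
  have [gr|gr] := ltP (g y - r) 0.
    apply: nearW => n; have := bumps_ge0 (s n) y; have := sg n y => h1 h2.
    by rewrite /= ltr_norml; apply/andP; split; lra.
  have gry : g y - r < g y by lra.
  have [c cg' cy] := bump_below cg g0 gr gry.
  exists (pickle c).+1 => // n /= cn.
  have : bump c y <= bumps (s n) y.
    apply: (le_bigmax_seq _ c) => //; rewrite mem_filter; apply/andP; split.
      exact/asboolP.
    rewrite mem_pmap; apply/mapP; exists (pickle c); last by rewrite pickleK.
    by rewrite mem_iota.
  have := sg n y => h1 h2.
  by rewrite /= ltr_norml; apply/andP; split; lra.
have := @cvg_monotone_convergence _ (borel X) R mu setT measurableT
  (fun n y => (bumps (s n) y)%:E).
have -> : (\int[mu]_x limn (fun n => (bumps (s n) x)%:E) =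
           \int[mu]_x (g x)%:E)%E.
  by apply: eq_integral => y _; exact: (cvg_lim _ (s_cvg y)).
rewrite -EFin_Rintegral_bcfun// => cvgI.
have /fine_cvg/cvgr_gt/(_ _ tg)[N _ /(_ N (leqnn N)) tN] :
    (\int[mu]_x (bumps (s n) x)%:E)%E @[n --> \oo] --> (\int[mu]_x g x)%:E.
  apply: cvgI => [n|n y _|y _ m n mn].
  - apply/measurable_EFinP; apply: continuous_borel_measurable.
    exact: bumps_continuous.
  - by rewrite lee_fin bumps_ge0.
  - by rewrite lee_fin s_mono.
by exists (s N).
Qed.

Lemma bumps_subbase (mu : probability (borel X) R) (f : bcfun R X) (r : R) :
  0 < r -> exists s1 s2 : seq code * rat,
    [/\ ratr s1.2 < \int[mu]_x bumps s1.1 x, ratr s2.2 < \int[mu]_x bumps s2.1 x &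
     forall nu : probability (borel X) R,
       ratr s1.2 < \int[nu]_x bumps s1.1 x -> ratr s2.2 < \int[nu]_x bumps s2.1 x ->
       `|integral_map mu f - integral_map nu f| < r].
Proof.
move=> r0; case: f => f [cf bf]; rewrite /integral_map/=.
have [M fM] : exists M : R, forall x, `|f x| <= M.
  have /(@ex_bound _ _ _ f _ (globally_properfilter (a := point) I))[M fM] := bf.
  by exists M => x; exact: fM.
have cM : continuous (cst M : X -> R) by move=> x; exact: cvg_cst.
have bM : bounded_fun (cst M : X -> R).
  by apply/(@ex_bound _ _ _ _ _ (globally_properfilter (a := point) I));
    exists `|M| => x _ /=.
(* Used for [f] and for [- f], this one-sided estimate gives both halves of the absolute value.
   Adding [M] makes [g] nonnegative, and [M] cancels because all the measures have mass 1. *)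
have below (g : X -> R) : continuous g -> bounded_fun g -> (forall y, `|g y| <= M) ->
  exists s : seq code * rat, ratr s.2 < \int[mu]_x bumps s.1 x /\
   forall nu : probability (borel X) R, ratr s.2 < \int[nu]_x bumps s.1 x ->
     \int[mu]_x g x - r < \int[nu]_x g x.
  move=> cg bg gM.
  have cgM : continuous (g \+ cst M).
    by move=> x; apply: cvgD; [exact: cg|exact: cM].
  have bgM : bounded_fun (g \+ cst M) by exact: bounded_funD.
  have gM0 y : 0 <= (g \+ cst M) y.
    by have := gM y; rewrite ler_norml/= => /andP[]; lra.
  have intE (nu : probability (borel X) R) :
      \int[nu]_x (g \+ cst M) x = \int[nu]_x g x + M.
    rewrite RintegralD//; try exact: bcfun_integrable.
    rewrite Rintegral_cst// [X in fine X](_ : _ = 1%E) ?mulr1//.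
    exact: probability_setT.
  have tM : \int[mu]_x g x + M - r < \int[mu]_x (g \+ cst M) x.
    by rewrite intE; lra.
  have [s sg ts] := integral_bumps_below cgM bgM gM0 tM.
  (* A rational threshold keeps the family of subbasic sets countable. *)
  have [a] := rat_in_itvoo ts; rewrite in_itv/= => /andP[ta atb].
  exists (s, a); split=> // nu /= anu.
  have : \int[nu]_x bumps s x <= \int[nu]_x (g \+ cst M) x.
    apply: le_Rintegral => //.
      by apply: bcfun_integrable; [exact: bumps_continuous|exact: bumps_bounded].
    exact: bcfun_integrable.
  by rewrite intE; lra.
have [s1 [h1 k1]] := below f cf bf fM.
have cN : continuous (- f) by move=> x; apply: cvgN; exact: cf.
have bN : bounded_fun (- f) by exact: bounded_funN.
have NM y : `|(- f) y| <= M by rewrite normrN.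
have [s2 [h2 k2]] := below (- f) cN bN NM.
have intN (nu : probability (borel X) R) : \int[nu]_x (- f) x = - \int[nu]_x f x.
  have := @RintegralZl _ _ _ nu setT f (-1) measurableT (bcfun_integrable nu cf bf).
  by rewrite mulN1r => <-; apply: eq_Rintegral => x _; rewrite mulN1r.
exists s1, s2; split=> // nu /k1 + /k2; rewrite !intN => l1 l2.
by rewrite ltr_norml; apply/andP; split; lra.
Qed.

(** * The countable base and the limit measures *)

Implicit Types l : seq (seq code * rat).

(** A list codes a finite intersection of subbasic sets, so the base is indexed by a countable
    type. *)
Definition basic_set l : set (borel_prob R X) :=
  [set nu : probability (borel X) R |
    forall p, p \in l -> ratr p.2 < \int[nu]_x bumps p.1 x].

Lemma basic_set_nbhs l (mu : borel_prob R X) :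
  basic_set l mu -> nbhs mu (basic_set l).
Proof.
elim: l => [|p l IH] lmu; first by apply: filterS filterT => nu _ p.
have /IH lnear : basic_set l mu.
  by move=> q ql; apply: lmu; rewrite inE ql orbT.
have pnear : \forall nu \near mu,
    ratr p.2 < integral_map nu (bumps_bcfun p.1).
  have /cvg_borel_probP/(_ (bumps_bcfun p.1)) /cvgr_gt : nbhs mu --> mu by [].
  by apply; apply: lmu; rewrite mem_head.
apply: filterS2 lnear pnear => nu lnu pnu q.
by rewrite inE => /predU1P[->//|]; exact: lnu.
Qed.

Lemma cvg_basic_set (u : nat -> borel_prob R X) (mu : borel_prob R X) :
  (forall l, basic_set l mu -> \forall n \near \oo, basic_set l (u n)) ->
  u @ \oo --> mu.
Proof.
move=> umu; apply/cvg_borel_probP => f; apply/cvgrPdist_lt => r r0.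
have [p [q [pmu qmu pq]]] := bumps_subbase mu f r0.
have /umu : basic_set [:: p; q] mu.
  by move=> c; rewrite !inE => /predU1P[->//|/eqP->].
apply: filterS => n pqn; apply: pq; apply: pqn; rewrite !inE eqxx ?orbT//.
Qed.

Context (T : X -> X).
Hypothesis cT : continuous T.

Lemma open_basic_set_empirical l n :
  open [set x | basic_set l (empirical R T x n)].
Proof.
elim: l => [|p l IH].
  rewrite (_ : mkset _ = setT); first exact: openT.
  by apply/seteqP; split.
rewrite (_ : mkset _ =
    (fun x => \int[empirical_measure R T x n]_y bumps p.1 y) @^-1`
       [set t | ratr p.2 < t] `&`
    [set x | basic_set l (empirical R T x n)]); last first.
  apply/seteqP; split=> [x px|x [/= px lx] q].
    split; first by apply: px; rewrite mem_head.
    by move=> q ql; apply: px; rewrite inE ql orbT.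
  by rewrite inE => /predU1P[->//|]; exact: lx.
apply: openI => //; apply: open_comp; last exact: open_gt.
move=> x _; apply: integral_empirical_continuous => //.
  exact: bumps_continuous.
exact: bumps_ge0.
Qed.

(** For the converse, a subsequence is chosen diagonally along the decreasing basic sets of [ls k],
    which eventually refine every basic set containing [mu]. *)
Lemma limit_measuresP x (mu : borel_prob R X) : limit_measures T x mu <->
  forall l, basic_set l mu ->
    forall N, exists2 n, (N <= n)%N & basic_set l (empirical R T x n).
Proof.
split=> [[s s_mono smu] l lmu N|rec].
  have [M _ Ml] : \forall k \near \oo, basic_set l (empirical R T x (s k)).
    exact/smu/basic_set_nbhs.
  have s_ge k : (k <= s k)%N.
    by elim: k => // k IH; rewrite (leq_ltn_trans IH)// s_mono.
  exists (s (maxn M N)); last by apply: Ml; rewrite /= leq_maxl.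
  by rewrite (leq_trans _ (s_ge _))// leq_maxr.
pose ls k := [seq p <- pmap unpickle (iota 0 k)
               | `[< ratr p.2 < \int[mu]_x bumps p.1 x >]] : seq (seq code * rat).
have lsmu k : basic_set (ls k) mu.
  by move=> p; rewrite mem_filter => /andP[/asboolP].
have /choice[F FP] (kN : nat * nat) : exists n,
    (kN.2 <= n)%N /\ basic_set (ls kN.1) (empirical R T x n).
  by have [n ? ?] := rec _ (lsmu kN.1) kN.2; exists n.
(* Asking for a visit no earlier than [(s j).+1] makes [s] strictly increasing. *)
pose s := fix s k := if k is j.+1 then F (k, (s j).+1) else F (0, 0)%N.
exists s.
  by apply: homo_ltn ltn_trans _ => k; have [] := FP (k.+1, (s k).+1).
have sP k : basic_set (ls k) (empirical R T x (s k)).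
  by case: k => [|k]; [have [] := FP (0, 0)%N|have [] := FP (k.+1, (s k).+1)].
apply: cvg_basic_set => l lmu.
(* From this index on, [ls n] contains every entry of [l]. *)
exists (\max_(p <- l) (pickle p).+1)%N => // n /= ln p pl.
apply: sP; rewrite mem_filter; apply/andP; split; first exact/asboolP/lmu.
rewrite mem_pmap; apply/mapP; exists (pickle p); last by rewrite pickleK.
rewrite mem_iota/= add0n (leq_trans _ ln)//.
by rewrite (@leq_bigmax_seq _ l xpredT (fun q => (pickle q).+1)).
Qed.

Lemma Gdelta_limit_measures (V : set (borel_prob R X)) :
  Gdelta [set x | V `<=` limit_measures T x].
Proof.
(* Each pair of a base set and a time bound gets one open condition. An index that codes no pair, or
   whose base set misses [V], imposes nothing. *)
pose A i : set X := [set x | forall lN : seq (seq code * rat) * nat,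
  unpickle i = Some lN -> V `&` basic_set lN.1 !=set0 ->
  exists2 n, (lN.2 <= n)%N & basic_set lN.1 (empirical R T x n)].
exists A => [i|].
  case E : (unpickle i : option (seq (seq code * rat) * nat)) => [[l N]|];
      last first.
    rewrite (_ : A i = setT); first exact: openT.
    by apply/seteqP; split=> // x _ lN; rewrite E.
  have [Vl|Vl] := pselect (V `&` basic_set l !=set0); last first.
    rewrite (_ : A i = setT); first exact: openT.
    by apply/seteqP; split=> // x _ lN; rewrite E => -[<-] /=.
  rewrite (_ : A i = \bigcup_(n in [set n | (N <= n)%N])
      [set x | basic_set l (empirical R T x n)]).
    by apply: bigcup_open => n _; exact: open_basic_set_empirical.
  apply/seteqP; split=> [x /(_ _ E Vl)[n Nn ln]|x [n Nn ln]]; first by exists n.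
  by move=> lN; rewrite E => -[<-] _; exists n.
apply/seteqP; split=> [x /= Vx i _ [l N] _ /= [mu [/Vx/limit_measuresP mux]]|].
  by move=> lmu; exact: mux.
move=> x Ax mu Vmu; apply/limit_measuresP => l lmu N.
by apply: (Ax (pickle (l, N)) I (l, N)); [exact: pickleK|exists mu].
Qed.

End bumps.

(** * A dense sequence and the conclusion *)

Lemma separable_dense_seq (X : ptopologicalType) : separable X ->
  exists e : nat -> X, forall O : set X, O !=set0 -> open O -> exists k, O (e k).
Proof.
move=> [D cD dD]; move: cD => /pfcard_geP[D0|[e]].
  (* Density rules out an empty [D], since the space contains [point]. *)
  have [x []] := dD setT (ex_intro _ point I) openT.
  by rewrite D0.
exists e => O O0 oO; have [x [Ox /(@surj _ _ _ _ e)[k _ kx]]] := dD O O0 oO.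
by exists k; rewrite kx.
Qed.

Theorem fact16 (R : realType) (X : ptopologicalType) (T : X -> X)
    (V : set (borel_prob R X)) :
  polish R X -> continuous T ->
  V `<=` invariant_measures T -> closed V ->
  Gdelta [set x : X | V `<=` limit_measures T x].
Proof.
move=> [/separable_dense_seq[e eP] [dist [dm dE _]]] cT _ _.
apply: (Gdelta_limit_measures dm dE (e := e)) => // x r r0.
have dx : nbhs x [set y | dist x y < r] by apply/dE; exists r.
(* Density speaks of open sets, hence the interior of the ball, which contains [x]. *)
have [|k] := eP _ _ (@open_interior _ [set y | dist x y < r]).
  by exists x.
by move=> /interior_subset /=; case: dm => _ _ -> _; exists k.
Qed.
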